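(* Let a prior network with boundary conditions and positive weights $d_{kl}$ be given, and suppose there is at least one flow vertex, $\mathcal F\neq\emptyset$. For $K>0$, call a physical network $(\kappa_{kl})$ minimally dissipative with material constraint $K$ if it globally minimizes $$D=\sum_{k>l,\langle k,l\rangle=1}\frac{Q_{kl}^2}{\kappa_{kl}}$$ among all physical networks with $\sum_{k>l,\langle k,l\rangle=1}\kappa_{kl}^{1/2}d_{kl}=K$. For $a>0$, call a physical network minimally dissipative with material penalty $a$ if it globally minimizes $$\Theta=\sum_{k>l,\langle k,l\rangle=1}\frac{Q_{kl}^2}{\kappa_{kl}}+a\sum_{k>l,\langle k,l\rangle=1}\kappa_{kl}^{1/2}d_{kl}$$ among all physical networks. Here $Q_{kl}$ is always the Kirchhoff flow of the network in question. Then there is a bijection $a\mapsto K(a)$ from $(0,\infty)$ onto $(0,\infty)$ such that for every $a>0$, a physical network is minimally dissipative with material penalty $a$ if and only if it is minimally dissipative with material constraint $K(a)$.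
   Context: Prior network: a finite simple undirected graph on vertices $1,\dots,V$ with at least one edge; $\langle k,l\rangle=1$ means $k,l$ are joined by an edge ($\langle k,l\rangle=\langle l,k\rangle$), and $\langle k,l\rangle=0$ otherwise. Each edge carries a fixed weight $d_{kl}=d_{lk}>0$. Boundary conditions: disjoint vertex sets $\mathcal P$ (pressure vertices, each with prescribed pressure $\bar p_k\in\mathbb R$) and $\mathcal F$ (flow vertices, each with prescribed inflow $q_k\in\mathbb R$, $q_k\neq 0$; vertices with zero prescribed inflow are by convention not in $\mathcal F$). Put $q_k=0$ for $k\notin\mathcal P\cup\mathcal F$. A network is a choice of conductances $\kappa_{kl}=\kappa_{lk}\ge 0$ on the edges. A Kirchhoff flow is $Q_{kl}=(p_k-p_l)\kappa_{kl}$ on the edges (so $Q_{kl}=-Q_{lk}$), where the pressures $p_k$ satisfy $p_k=\bar p_k$ for $k\in\mathcal P$ and $\sum_{l:\langle k,l\rangle=1}(p_k-p_l)\kappa_{kl}=q_k$ for $k\notin\mathcal P$. The network is physical if there is exactly one Kirchhoff flow (equivalently, every connected component of the subgraph of edges with $\kappa_{kl}>0$ contains a vertex of $\mathcal P$ or has total prescribed inflow zero). Standing assumption: the network with all $\kappa_{kl}>0$ is physical. Convention: a term $Q_{kl}^2/\kappa_{kl}$ with $\kappa_{kl}=0$ and $Q_{kl}=0$ is $0$. *)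

(* Defs.v *)
From HB Require Import structures.
From mathcomp Require Import all_boot all_order all_algebra.
From mathcomp Require Import boolp classical_sets functions reals.
Set Implicit Arguments. Unset Strict Implicit. Unset Printing Implicit Defensive.
Import Order.TTheory GRing.Theory Num.Theory.
Local Open Scope ring_scope.

Record prior_network (R : realType) (V : nat) := PriorNetwork {
  adj : rel 'I_V;
  adj_sym : symmetric adj;
  adj_irr : irreflexive adj;
  adj_edge : exists k l, adj k l;
  weight : 'I_V -> 'I_V -> R;
  weight_sym : forall k l, adj k l -> weight k l = weight l k;
  weight_gt0 : forall k l, adj k l -> 0 < weight k l
}.

(* [pbar] is only read on [pvert] and [qbar] only on [fvert]. *)
Record boundary (R : realType) (V : nat) := Boundary {
  pvert : {set 'I_V};
  fvert : {set 'I_V};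
  pf_disjoint : [disjoint pvert & fvert];
  pbar : 'I_V -> R;
  qbar : 'I_V -> R;
  qbar_neq0 : forall k, k \in fvert -> qbar k != 0
}.

Section Network.
Context (R : realType) (V : nat) (G : prior_network R V) (B : boundary R V).
Implicit Types (kappa Q : 'M[R]_V).

Definition inflow (k : 'I_V) : R := if k \in fvert B then qbar B k else 0.

(* Matrices are 0 off the edges, so that they correspond one-to-one to choices
   of conductances on the edges. *)
Definition is_network kappa : Prop :=
  [/\ forall k l, kappa k l = kappa l k,
      forall k l, adj G k l -> 0 <= kappa k l
    & forall k l, ~~ adj G k l -> kappa k l = 0].

(* For a network, such a Q vanishes off the edges; hence uniqueness of Q as a
   matrix is uniqueness of the flow on the edges. The pressures p need not be
   unique. *)
Definition is_kirchhoff_flow kappa Q : Prop :=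
  exists p : 'I_V -> R,
    [/\ forall k, k \in pvert B -> p k = pbar B k,
        forall k, k \notin pvert B ->
          \sum_(l | adj G k l) (p k - p l) * kappa k l = inflow k
      & forall k l, Q k l = (p k - p l) * kappa k l].

Definition physical kappa : Prop :=
  is_network kappa /\ exists! Q, is_kirchhoff_flow kappa Q.

(* The Kirchhoff flow of a physical network (arbitrary otherwise). *)
Definition kflow kappa : 'M[R]_V := xget 0 [set Q | is_kirchhoff_flow kappa Q]%classic.

(* As 0^-1 = 0, edges with zero conductance contribute 0. *)
Definition dissipation kappa : R :=
  \sum_(k < V) \sum_(l < V | (l < k)%N && adj G k l)
    kflow kappa k l ^+ 2 / kappa k l.

Definition material kappa : R :=
  \sum_(k < V) \sum_(l < V | (l < k)%N && adj G k l)
    Num.sqrt (kappa k l) * weight G k l.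

Definition min_dissipative_constraint (K : R) kappa : Prop :=
  [/\ physical kappa, material kappa = K &
      forall kappa', physical kappa' -> material kappa' = K ->
        dissipation kappa <= dissipation kappa'].

Definition min_dissipative_penalty (a : R) kappa : Prop :=
  physical kappa /\
  forall kappa', physical kappa' ->
    dissipation kappa + a * material kappa <=
    dissipation kappa' + a * material kappa'.

End Network.

(* Main.v *)
(** Write [Phi(Q)] for the sum of [|Q|^(2/3) d^(2/3)] over the edges. By the
    arithmetic-geometric mean inequality on each edge, a physical network with
    flow [Q] satisfies [D + 2 c^3 M >= 3 c^2 Phi(Q)] for all [c > 0], where [M]
    is its material. Conversely, as [Phi] is concave between sign changes, any
    flow can be moved along circulations, without increasing [Phi], until its
    support carries no circulation. Every function on the edges of such a
    support is a potential difference with prescribed pressures, so for each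
    [c > 0] the resulting flow [Q'] is the Kirchhoff flow of a network with
    [D = c^2 Phi(Q')] and [M = Phi(Q') / c]. Hence, with [m > 0] the infimum of
    [Phi] over all flows, the infimum of [D + 2 c^3 M] is [3 c^2 m], reached
    exactly by the networks with [M = m / c] and [D = c^2 m], and the infimum of
    [D] at [M = m / c] is [c^2 m]. So [K (2 c^3) = m / c]; whether the infima are
    attained plays no role. *)
Require Import Defs.
From HB Require Import structures.
From mathcomp Require Import all_boot all_order all_algebra.
From mathcomp Require Import boolp classical_sets functions reals.
From mathcomp Require Import exp ring lra.
Set Implicit Arguments. Unset Strict Implicit. Unset Printing Implicit Defensive.
Import Order.TTheory GRing.Theory Num.Theory.
Local Open Scope ring_scope.

(** * Cube roots, a cubic inequality and linear duality *)

Definition cbrt (R : realType) (z : R) : R := powR `|z| 3^-1.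

Lemma cbrt_ge0 (R : realType) (z : R) : 0 <= cbrt z.
Proof. exact: powR_ge0. Qed.

Lemma cbrtK (R : realType) (z : R) : cbrt z ^+ 3 = `|z|.
Proof.
rewrite /cbrt -powR_mulrn ?powR_ge0// -powRrM mulVf ?powRr1//.
by rewrite pnatr_eq0.
Qed.

Lemma cbrt_gt0 (R : realType) (z : R) : z != 0 -> 0 < cbrt z.
Proof. by move=> z0; rewrite powR_gt0// normr_gt0. Qed.

Lemma cbrt0 (R : realType) : cbrt (0 : R) = 0.
Proof. by apply/eqP; rewrite -[_ == 0](expf_eq0 _ 3) cbrtK normr0. Qed.

Lemma cbrtN (R : realType) (z : R) : cbrt (- z) = cbrt z.
Proof. by rewrite /cbrt normrN. Qed.

Lemma cbrtX (R : realType) (z : R) : 0 <= z -> cbrt (z ^+ 3) = z.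
Proof.
move=> z0; apply/eqP; rewrite -(@eqrXn2 _ 3)// ?cbrt_ge0// cbrtK.
by rewrite ger0_norm// exprn_ge0.
Qed.

(** The inequality of means for [x^3], [y^3], [y^3]. It doubles as the tangent line inequality at
    [x^3] for the concave function [z^(2/3)]. *)
Lemma cubic_AGM (R : realDomainType) (x y : R) : 0 <= x -> 0 <= y ->
  3 * x * y ^+ 2 <= x ^+ 3 + 2 * y ^+ 3.
Proof.
move=> x0 y0; rewrite -subr_ge0.
have -> : x ^+ 3 + 2 * y ^+ 3 - 3 * x * y ^+ 2 = (x - y) ^+ 2 * (x + 2 * y).
  by ring.
by rewrite mulr_ge0 ?sqr_ge0// addr_ge0// mulr_ge0.
Qed.

(** The row [u] lies in the row space of [A] as soon as the cokernel of [A] kills it, and each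
    column of the cokernel is a [y] as in the hypothesis. *)
Lemma fredholm (F : fieldType) (n : nat) (J : finType) (A : 'I_n -> J -> F)
    (u : J -> F) :
  (forall y : J -> F, (forall i, \sum_j A i j * y j = 0) ->
    \sum_j u j * y j = 0) ->
  exists p : 'I_n -> F, forall j, \sum_i p i * A i j = u j.
Proof.
move=> H.
have E (f : J -> F) : \sum_j f j = \sum_(j < #|J|) f (enum_val j).
  by rewrite (reindex (fun j : 'I_#|J| => enum_val j))//; exact: onW_bij (enum_val_bij _).
pose M : 'M[F]_(n, #|J|) := \matrix_(i, j) A i (enum_val j).
pose v : 'rV[F]_#|J| := \row_j u (enum_val j).
have /submxP[D vD] : (v <= M)%MS.
  rewrite submxE; apply/eqP/matrixP => i c; rewrite !mxE.
  pose y j := cokermx M (enum_rank j) c.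
  have uy : \sum_j u j * y j = 0.
    apply: H => k; have /matrixP/(_ k c) := mulmx_coker M.
    rewrite !mxE E => MK; rewrite -[RHS]MK.
    by apply: eq_bigr => j _; rewrite mxE /y enum_valK.
  by rewrite -[RHS]uy E; apply: eq_bigr => j _; rewrite mxE /y enum_valK.
exists (D 0) => j.
have /matrixP/(_ 0 (enum_rank j)) := vD; rewrite !mxE enum_rankK => ->.
by apply: eq_bigr => i _; rewrite mxE enum_rankK.
Qed.

Lemma sum_pairE (R : nmodType) (I J : finType) (f : I * J -> R) :
  \sum_e f e = \sum_i \sum_j f (i, j).
Proof.
by rewrite (pair_bigA _ (fun i j => f (i, j))); apply: eq_bigr => -[].
Qed.

Section Flows.
Context (R : realType) (V : nat) (G : prior_network R V) (B : boundary R V).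
Implicit Types (kappa Q C : 'M[R]_V).

(** * Sums over edges *)

Definition edge_sum (f : 'I_V -> 'I_V -> R) : R :=
  \sum_(k < V) \sum_(l < V | (l < k)%N && adj G k l) f k l.

Lemma edge_sumE f : edge_sum f =
  \sum_(e : 'I_V * 'I_V | (e.2 < e.1)%N && adj G e.1 e.2) f e.1 e.2.
Proof. exact: pair_big_dep. Qed.

Lemma eq_edge_sum f g : (forall k l, adj G k l -> f k l = g k l) ->
  edge_sum f = edge_sum g.
Proof.
by move=> fg; apply: eq_bigr => k _; apply: eq_bigr => l /andP[_]; exact: fg.
Qed.

Lemma edge_sumD f g :
  edge_sum (fun k l => f k l + g k l) = edge_sum f + edge_sum g.
Proof. by rewrite !edge_sumE big_split. Qed.

Lemma edge_sumZ c f : edge_sum (fun k l => c * f k l) = c * edge_sum f.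
Proof. by rewrite !edge_sumE mulr_sumr. Qed.

Lemma ler_edge_sum f g : (forall k l, adj G k l -> f k l <= g k l) ->
  edge_sum f <= edge_sum g.
Proof.
by move=> fg; apply: ler_sum => k _; apply: ler_sum => l /andP[_]; exact: fg.
Qed.

Lemma ler_edge_term f k l : (forall k l, adj G k l -> 0 <= f k l) ->
  (forall k l, adj G k l -> f k l = f l k) -> adj G k l -> f k l <= edge_sum f.
Proof.
move=> f0 fC.
wlog lk : k l / (l < k)%N.
  move=> H; case: (ltngtP l k); first exact: H.
    by move=> kl akl; rewrite (fC _ _ akl); apply: H => //; rewrite (@adj_sym _ _ G).
  by move/val_inj => ->; rewrite adj_irr.
move=> akl; rewrite edge_sumE (bigD1 (k, l))/= ?lk//.
by rewrite lerDl sumr_ge0// => e /andP[/andP[_ ?] _]; apply: f0.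
Qed.

Lemma edge_sum_eq0 f : (forall k l, adj G k l -> 0 <= f k l) ->
  (forall k l, adj G k l -> f k l = f l k) -> edge_sum f <= 0 ->
  forall k l, adj G k l -> f k l = 0.
Proof.
move=> f0 fC fle0 k l akl; apply/le_anti; rewrite f0// andbT.
exact: le_trans (ler_edge_term f0 fC akl) fle0.
Qed.

(** * Circulations, flows and their cost *)

Definition is_circulation C : Prop :=
  [/\ forall k l, C l k = - C k l, forall k l, ~~ adj G k l -> C k l = 0
    & forall k, k \notin pvert B -> \sum_l C k l = 0].

Definition is_flow Q : Prop :=
  [/\ forall k l, Q l k = - Q k l, forall k l, ~~ adj G k l -> Q k l = 0
    & forall k, k \notin pvert B -> \sum_l Q k l = inflow B k].

Definition supp_sub C Q : Prop := forall k l, Q k l = 0 -> C k l = 0.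

(** Circulations need not be conserved at pressure vertices, so for a flow this also excludes paths
    in the support between two pressure vertices. *)
Definition acyclic Q : Prop :=
  forall C, is_circulation C -> supp_sub C Q -> C = 0.

(* [\sum |Q|^(2/3) d^(2/3)], the minimum over all conductances of
   [(\sum Q^2 / kappa)^(1/3) (\sum kappa^(1/2) d)^(2/3)]. *)
Definition flow_cost Q : R := edge_sum (fun k l =>
  cbrt (Q k l) ^+ 2 * cbrt (weight G k l) ^+ 2).

Lemma cbrt_weight_gt0 k l : adj G k l -> 0 < cbrt (weight G k l).
Proof. by move=> akl; rewrite cbrt_gt0// gt_eqF// weight_gt0. Qed.

Lemma cbrt_weightK k l : adj G k l -> cbrt (weight G k l) ^+ 3 = weight G k l.
Proof. by move=> akl; rewrite cbrtK gtr0_norm// weight_gt0. Qed.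

Lemma flow_cost_ge0 Q : 0 <= flow_cost Q.
Proof.
rewrite /flow_cost edge_sumE sumr_ge0// => e _.
by rewrite mulr_ge0// sqr_ge0.
Qed.

Lemma sum_adj Q k : (forall k l, ~~ adj G k l -> Q k l = 0) ->
  \sum_(l | adj G k l) Q k l = \sum_l Q k l.
Proof.
by move=> Q0; rewrite big_mkcond; apply: eq_bigr => l _; case: ifPn => // /Q0.
Qed.

(** Discrete summation by parts. *)
Lemma sum_antisym_potential C (h : 'I_V -> R) :
  (forall k l, C l k = - C k l) ->
  \sum_k \sum_l C k l * (h k - h l) = 2 * \sum_k h k * \sum_l C k l.
Proof.
move=> CN.
have -> : \sum_k \sum_l C k l * (h k - h l) =
    \sum_k \sum_l h k * C k l + \sum_k \sum_l h l * C l k.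
  rewrite -big_split; apply: eq_bigr => k _; rewrite -big_split.
  by apply: eq_bigr => l _ /=; rewrite CN; ring.
rewrite [X in _ + X]exchange_big /= -mulr2n mulr_natl.
by congr (_ *+ 2); apply: eq_bigr => k _; rewrite mulr_sumr.
Qed.

(** * Kirchhoff flows and their uniqueness *)

Lemma network_ge0 kappa k l : is_network G kappa -> 0 <= kappa k l.
Proof.
by move=> [_ k0 koff]; have [/k0//|/koff->] := boolP (adj G k l).
Qed.

Lemma kirchhoff_flow_is_flow kappa Q : is_network G kappa ->
  is_kirchhoff_flow G B kappa Q -> is_flow Q.
Proof.
move=> [ks k0 koff] [p [pP pF QE]].
have Qoff k l : ~~ adj G k l -> Q k l = 0 by move=> /koff kl; rewrite QE kl mulr0.
split => // [k l|k kP]; first by rewrite !QE ks; ring.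
by rewrite -sum_adj// -(pF _ kP); apply: eq_bigr => l _.
Qed.

(** Energy argument: [Q - Q'] is driven by [h = p - p'], which vanishes at pressure vertices, and is
    conserved at all others. Summation by parts makes its energy zero, hence every term
    [kappa * (h k - h l)^2]. *)
Lemma kirchhoff_flow_uniq kappa Q Q' : is_network G kappa ->
  is_kirchhoff_flow G B kappa Q -> is_kirchhoff_flow G B kappa Q' -> Q = Q'.
Proof.
move=> kN KQ KQ'.
have [QN _ Qsum] := kirchhoff_flow_is_flow kN KQ.
have [Q'N _ Q'sum] := kirchhoff_flow_is_flow kN KQ'.
have [p [pP _ QE]] := KQ; have [p' [p'P _ Q'E]] := KQ'.
pose h k := p k - p' k.
have CE k l : (Q - Q') k l = (h k - h l) * kappa k l.
  by rewrite !mxE QE Q'E /h; ring.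
have energy : \sum_k \sum_l (Q - Q') k l * (h k - h l) = 0.
  rewrite sum_antisym_potential; last by move=> k l; rewrite !mxE QN Q'N; ring.
  rewrite big1 ?mulr0// => k _.
  have [kP|kP] := boolP (k \in pvert B); first by rewrite /h pP// p'P// subrr mul0r.
  under eq_bigr do rewrite !mxE.
  by rewrite sumrB Qsum// Q'sum// subrr mulr0.
have sq k l : (Q - Q') k l * (h k - h l) = kappa k l * (h k - h l) ^+ 2.
  by rewrite CE; ring.
have pos k l : 0 <= (Q - Q') k l * (h k - h l).
  by rewrite sq mulr_ge0 ?sqr_ge0// network_ge0.
apply/matrixP => k l; apply/eqP; rewrite -subr_eq0.
have row0 := psumr_eq0P (fun k _ => sumr_ge0 _ (fun l _ => pos k l)) energy.
have /eqP := @psumr_eq0P _ _ _ _ (fun l _ => pos k l) (row0 k isT) l isT.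
have -> : Q k l - Q' k l = (Q - Q') k l by rewrite !mxE.
rewrite mulf_eq0 => /orP[//|/eqP h0].
by rewrite CE h0 mul0r.
Qed.

Lemma physicalP kappa : is_network G kappa ->
  (exists Q, is_kirchhoff_flow G B kappa Q) -> physical G B kappa.
Proof.
move=> kN [Q KQ]; split=> //; exists Q; split=> // Q'.
exact: kirchhoff_flow_uniq KQ.
Qed.

Lemma kflowP kappa : physical G B kappa ->
  is_kirchhoff_flow G B kappa (kflow G B kappa).
Proof. by move=> [_ [Q [KQ _]]]; apply: xgetPex; exists Q. Qed.

Lemma kflow_is_flow kappa : physical G B kappa -> is_flow (kflow G B kappa).
Proof.
by move=> kphys; case: (kphys) => kN _; exact: kirchhoff_flow_is_flow (kflowP kphys).
Qed.

(** * Lower bounds for the penalty and for the cost *)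

Lemma material_ge0 kappa : 0 <= material G kappa.
Proof.
rewrite /material; apply: sumr_ge0 => k _; apply: sumr_ge0 => l /andP[_ akl].
by rewrite mulr_ge0// ?sqrtr_ge0// ltW// weight_gt0.
Qed.

(** With [s^2 = kappa], [x^3 = |Q|] and [d^3] the weight, each edge is [cubic_AGM] at [x^2] and
    [c * s * d], divided by [s^2]. *)
Lemma penalty_ge_flow_cost kappa (c : R) : 0 < c -> physical G B kappa ->
  3 * c ^+ 2 * flow_cost (kflow G B kappa) <=
  dissipation G B kappa + 2 * c ^+ 3 * material G kappa.
Proof.
move=> c0 kphys; case: (kphys) => kN _.
have [p [_ _ QE]] := kflowP kphys.
rewrite -edge_sumZ -[material _ _]/(edge_sum _) -edge_sumZ -edge_sumD.
apply: ler_edge_sum => k l akl.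
have [k0|k0] := eqVneq (kappa k l) 0.
  by rewrite QE k0 mulr0 cbrt0 sqrtr0 expr0n/= !mul0r !mulr0 addr0.
have kpos : 0 < kappa k l by rewrite lt_def k0 network_ge0.
set s := Num.sqrt (kappa k l).
have s0 : 0 < s by rewrite sqrtr_gt0.
have -> : kappa k l = s ^+ 2 by rewrite sqr_sqrtr// ltW.
rewrite -[weight G k l in leRHS](cbrt_weightK akl).
set d := cbrt (weight G k l); have d0 : 0 < d by exact: cbrt_weight_gt0.
rewrite -[kflow _ _ _ k l ^+ 2]real_normK ?num_real// -cbrtK.
set x := cbrt (kflow _ _ _ k l).
rewrite -(@ler_pM2r _ (s ^+ 2)) ?exprn_gt0// [leRHS]mulrDl divfK ?expf_neq0 ?gt_eqF//.
have csd0 : 0 <= c * s * d by rewrite !mulr_ge0// ltW.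
have := cubic_AGM (sqr_ge0 x) csd0.
have -> : 3 * x ^+ 2 * (c * s * d) ^+ 2 =
  3 * c ^+ 2 * (x ^+ 2 * d ^+ 2) * s ^+ 2 by ring.
by congr (_ <= _); ring.
Qed.

(** No edge term exceeds the cost [Phi], so an edge of weight [w] carries at most [Phi^(3/2) / w].
    The edges at a flow vertex must together carry its nonzero inflow. *)
Lemma flow_cost_lbound : (exists k, k \in fvert B) ->
  exists2 e : R, 0 < e & forall Q, is_flow Q -> e <= flow_cost Q.
Proof.
move=> [k kF]; have q0 := qbar_neq0 kF.
have kP : k \notin pvert B.
  by apply/negP => kP; have /disjointFr/(_ kP) := pf_disjoint B; rewrite kF.
pose S := \sum_(l | adj G k l) (weight G k l)^-1.
have S0 : 0 <= S by apply: sumr_ge0 => l akl; rewrite invr_ge0 ltW// weight_gt0.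
have bound Q : is_flow Q ->
    `|qbar B k| <= Num.sqrt (flow_cost Q) * flow_cost Q * S.
  move=> [QN Qoff Qsum]; set r := Num.sqrt _.
  have rK : r ^+ 2 = flow_cost Q by rewrite sqr_sqrtr// flow_cost_ge0.
  have -> : qbar B k = inflow B k by rewrite /inflow kF.
  rewrite -Qsum// -sum_adj// (le_trans (ler_norm_sum _ _ _))// mulr_sumr.
  apply: ler_sum => l akl; rewrite -cbrtK -{1}(cbrt_weightK akl).
  set d := cbrt (weight G k l); have d0 : 0 < d by exact: cbrt_weight_gt0.
  set x := cbrt (Q k l).
  have xd : x ^+ 2 * d ^+ 2 <= r ^+ 2.
    rewrite rK /flow_cost; pose f i j := cbrt (Q i j) ^+ 2 * cbrt (weight G i j) ^+ 2.
    apply: (@ler_edge_term f) => // i j aij.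
      by rewrite /f mulr_ge0 ?sqr_ge0.
    by rewrite /f QN cbrtN weight_sym.
  have {}xd : x * d <= r.
    by rewrite -(@ler_pXn2r _ 2)// ?nnegrE ?exprMn// ?sqrtr_ge0// mulr_ge0 ?cbrt_ge0// ltW.
  rewrite ler_pdivlMr ?exprn_gt0// -rK -exprMn -exprS.
  by rewrite lerXn2r// nnegrE ?sqrtr_ge0// mulr_ge0 ?cbrt_ge0// ltW.
(* If [Phi < 1], then [Phi^(3/2) <= Phi], so the inflow is at most [Phi * S]; [S + 1] keeps the
   denominator positive. *)
exists (Num.min 1 (`|qbar B k| / (S + 1))).
  by rewrite lt_min ltr01 divr_gt0 ?normr_gt0//; lra.
move=> Q /bound; have := flow_cost_ge0 Q; set Phi := flow_cost Q => Phi0 le.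
have [Phi1|Phi1] := leP 1 Phi; first by rewrite ge_min Phi1.
rewrite ge_min; apply/orP; right; rewrite ler_pdivrMr; last lra.
apply: (le_trans le); rewrite -mulrA.
apply: (@le_trans _ _ (1 * (Phi * S))); last by nra.
rewrite ler_wpM2r ?mulr_ge0//.
by rewrite -[leRHS]sqrtr1 ler_wsqrtr// ltW.
Qed.

(** * Reduction to flows whose support carries no circulation *)

Definition supp_size Q := #|[set e : 'I_V * 'I_V | Q e.1 e.2 != 0]|.

(* Moving along a circulation until the first edge of the support vanishes; the
   direction is chosen so that the tangent of the concave cost does not
   increase. *)
Lemma reduce_step Q C : is_flow Q -> is_circulation C -> supp_sub C Q ->
  C != 0 -> exists Q',
  [/\ is_flow Q', (supp_size Q' < supp_size Q)%N & flow_cost Q' <= flow_cost Q].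
Proof.
move=> FQ.
(* Up to the factor [2 / 3], the derivative of the cost along [C]; edges with [Q = 0] contribute
   0. *)
pose slope C := edge_sum (fun k l =>
  cbrt (weight G k l) ^+ 2 * (Num.sg (Q k l) * C k l / cbrt (Q k l))).
wlog slope_le0 : C / slope C <= 0.
  move=> H [CN Coff C0] CQ nz; have [|] := leP (slope C) 0 => [/H|s0]; first exact.
  apply: (H (- C)); rewrite ?oppr_eq0//.
  - rewrite -oppr_ge0 -mulN1r -edge_sumZ (le_trans (ltW s0))//.
    by apply: ler_edge_sum => k l _; rewrite mxE; lra.
  - split=> [k l|k l akl|k kP]; rewrite ?mxE.
    + by rewrite CN.
    + by rewrite Coff ?oppr0.
    + by under eq_bigr do rewrite mxE; rewrite sumrN C0 ?oppr0.
  - by move=> k l /CQ; rewrite mxE => ->; rewrite oppr0.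
move=> [CN Coff C0] CQ nz; have [QN Qoff Qsum] := FQ.
pose P e := Num.sg (Q e.1 e.2) * C e.1 e.2 < 0.
(* If [C] opposed [Q] nowhere, the slope would be a sum of nonnegative terms with total at most 0,
   forcing [C = 0]. *)
have [e0 Pe0] : exists e, P e.
  apply/existsP; rewrite -[[exists _, _]]negbK; apply/negP => /existsPn noneg.
  have pos k l : 0 <= Num.sg (Q k l) * C k l by have := noneg (k, l); rewrite -leNgt.
  move/eqP: nz; apply; apply/matrixP => k l; rewrite mxE.
  have [akl|/Coff//] := boolP (adj G k l).
  have [Qkl|Qkl] := eqVneq (Q k l) 0; first exact: CQ.
  have := @edge_sum_eq0 _ _ _ slope_le0 k l akl.
  move=> /(_ _ _)/eqP; rewrite mulf_eq0 expf_eq0/= gt_eqF ?cbrt_weight_gt0//=.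
  rewrite mulf_eq0 invr_eq0 (gt_eqF (cbrt_gt0 Qkl)) orbF mulf_eq0 sgr_eq0.
  rewrite (negPf Qkl) => /(_ _ _)/eqP; apply.
    by move=> i j aij; rewrite mulr_ge0 ?sqr_ge0// divr_ge0// cbrt_ge0.
  by move=> i j aij; rewrite weight_sym// (QN i j) (CN i j) cbrtN sgrN mulrNN.
(* [t] is the first time at which an opposed edge reaches 0. Up to then no sign changes, so
   [|Q + t C|] is affine in [t]. *)
pose ratio e := `|Q e.1 e.2| / `|C e.1 e.2|.
have [e Pe emin] := arg_minP ratio Pe0; set t := ratio e.
have t0 : 0 <= t by rewrite divr_ge0.
have Ce : C e.1 e.2 != 0.
  by apply/eqP => Ce; move: Pe; rewrite /P Ce mulr0 ltxx.
have sgnorm k l : `|Q k l + t * C k l| = `|Q k l| + t * (Num.sg (Q k l) * C k l).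
  have [Qkl|Qkl] := eqVneq (Q k l) 0.
    by rewrite Qkl CQ// sgr0 !mulr0 !addr0 normr0.
  have -> : `|Q k l| + t * (Num.sg (Q k l) * C k l) =
      Num.sg (Q k l) * (Q k l + t * C k l) by rewrite normrEsg; ring.
  rewrite -[LHS]mul1r -[X in X * _ = _](_ : `|Num.sg (Q k l)| = 1); last first.
    by rewrite normr_sg Qkl.
  rewrite -normrM ger0_norm// mulrDr -normrEsg.
  have [nn|neg] := leP 0 (Num.sg (Q k l) * C k l).
    by rewrite addr_ge0// mulrCA mulr_ge0.
  have Ckl : C k l != 0.
    by apply/eqP => Ckl; move: neg; rewrite Ckl mulr0 ltxx.
  have sgC : Num.sg (Q k l) * C k l = - `|C k l|.
    by rewrite -[LHS]opprK -(ltr0_norm neg) normrM normr_sg Qkl mul1r.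
  rewrite mulrCA sgC mulrN subr_ge0 -ler_pdivlMr ?normr_gt0//.
  exact: (emin (k, l) neg).
exists (Q + t *: C).
have E k l : (Q + t *: C) k l = Q k l + t * C k l by rewrite !mxE.
split.
- split=> [k l|k l akl|k kP]; rewrite ?E.
  + by rewrite QN CN; ring.
  + by rewrite Qoff// Coff// mulr0 addr0.
  + under eq_bigr do rewrite E.
    by rewrite big_split/= -mulr_sumr C0// mulr0 addr0 Qsum.
- apply: proper_card; apply/fintype.properP; split.
    apply/fintype.subsetP => -[k l]; rewrite !inE E/=; apply: contra_neq => Qkl.
    by rewrite Qkl CQ// mulr0 addr0.
  exists e; rewrite !inE.
    by apply: contraTneq Pe => Qe; rewrite /P Qe sgr0 mul0r ltxx.
  rewrite negbK E -normr_eq0 sgnorm.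
  have -> : Num.sg (Q e.1 e.2) * C e.1 e.2 = - `|C e.1 e.2|.
    rewrite -[LHS]opprK -(ltr0_norm Pe) normrM normr_sg.
    rewrite -[_ != 0]negbK; case: eqP => [Qe|_]; last by rewrite mul1r.
    by move: Pe; rewrite /P Qe sgr0 mul0r ltxx.
  by rewrite mulrN /t /ratio divfK ?normr_eq0// subrr.
(* Edgewise, this is the tangent line inequality for [z^(2/3)] at [|Q|]. *)
have : flow_cost Q + 2 / 3 * t * slope C <= flow_cost Q.
  by rewrite gerDl mulr_ge0_le0// mulr_ge0// divr_ge0.
apply: le_trans; rewrite -edge_sumZ -edge_sumD; apply: ler_edge_sum => k l akl.
rewrite E; set d := cbrt (weight G k l).
have [Qkl|Qkl] := eqVneq (Q k l) 0.
  by rewrite Qkl CQ// mulr0 addr0 sgr0 cbrt0 !mul0r mulr0 expr0n/= mul0r mulr0 addr0.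
have x0 := cbrt_gt0 Qkl.
have := cubic_AGM (ltW x0) (cbrt_ge0 (Q k l + t * C k l)).
rewrite !cbrtK sgnorm -[`|Q k l|]cbrtK.
set x := cbrt (Q k l) in x0 *; set y := cbrt _; set g := Num.sg _ * _ => tang.
rewrite [leRHS](_ : _ = (x ^+ 2 + 2 / 3 * t * (g / x)) * d ^+ 2); last by ring.
rewrite ler_wpM2r ?sqr_ge0// -(@ler_pM2l _ (3 * x)) ?mulr_gt0//.
apply: (le_trans tang).
by rewrite le_eqVlt; apply/orP; left; apply/eqP; field; rewrite gt_eqF.
Qed.

Lemma reduce_acyclic Q : is_flow Q -> exists Q',
  [/\ is_flow Q', acyclic Q' & flow_cost Q' <= flow_cost Q].
Proof.
have [n] := ubnP (supp_size Q); elim: n Q => // n IH Q; rewrite ltnS => Qn FQ.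
have [acQ|] := pselect (acyclic Q); first by exists Q.
move=> /existsNP[C] /not_implyP[CC] /not_implyP[CQ] /eqP C0.
have [Q' [FQ' lt le]] := reduce_step FQ CC CQ C0.
have [Q'' [FQ'' ac le'']] := IH _ (leq_trans lt Qn) FQ'.
by exists Q''; split=> //; exact: le_trans le.
Qed.

(** * Networks realizing a flow without circulations in its support *)

(* By linear duality, the obstructions to solving for the potential are the
   circulations supported by [Q]. *)
Lemma acyclic_potential Q (b : 'I_V -> R) (e : 'I_V -> 'I_V -> R) : is_flow Q ->
  acyclic Q -> (forall k l, e l k = - e k l) ->
  exists p : 'I_V -> R, (forall k, k \in pvert B -> p k = b k) /\
    (forall k l, Q k l != 0 -> p k - p l = e k l).
Proof.
move=> [QN Qoff _] acQ eN.
(* One equation per prescribed pressure and one per potential difference on the support; the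
   indicators turn all others into [0 = 0]. *)
pose A (i : 'I_V) (j : 'I_V + 'I_V * 'I_V) : R := match j with
  | inl k => ((k \in pvert B) && (i == k))%:R
  | inr (k, l) => (Q k l != 0)%:R * ((i == k)%:R - (i == l)%:R) end.
pose u (j : 'I_V + 'I_V * 'I_V) : R := match j with
  | inl k => (k \in pvert B)%:R * b k
  | inr (k, l) => (Q k l != 0)%:R * e k l end.
have pick (k : 'I_V) (f : 'I_V -> R) : \sum_i f i * (i == k)%:R = f k.
  rewrite (bigD1 k)//= eqxx mulr1 big1 ?addr0// => i /negPf ->; exact: mulr0.
have [|p pE] := @fredholm _ _ _ A u; last first.
  exists p; split=> [k kP|k l Qkl].
    have := pE (inl k); rewrite /= kP mul1r => <-.
    by rewrite -[LHS]pick; apply: eq_bigr.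
  have := pE (inr (k, l)); rewrite /= Qkl mul1r => <-.
  rewrite -[p k]pick -[p l]pick -sumrB; apply: eq_bigr => i _.
  by rewrite mul1r mulrBr.
move=> y Ay.
(* A dual vector [y], antisymmetrized on the support, is a circulation: by [net], only pressure
   vertices can have nonzero divergence. *)
pose Y k l := (Q k l != 0)%:R * y (inr (k, l)).
pose C : 'M[R]_V := \matrix_(k, l) (Y k l - Y l k).
have net i : (i \in pvert B)%:R * y (inl i) + \sum_l C i l = 0.
  rewrite -[RHS](Ay i) big_sumType /=; congr (_ + _).
    rewrite -[LHS](pick i (fun k => (k \in pvert B)%:R * y (inl k))).
    apply: eq_bigr => k _; rewrite eq_sym -mulnb natrM; ring.
  rewrite sum_pairE/=.
  rewrite [RHS](_ : _ = \sum_k \sum_l Y k l * (k == i)%:R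
                     - \sum_k \sum_l Y k l * (l == i)%:R).
    under eq_bigr do rewrite mxE.
    rewrite sumrB; congr (_ - _).
      by rewrite exchange_big/=; apply: eq_bigr => l _; rewrite pick.
    by apply: eq_bigr => l _; rewrite pick.
  rewrite -sumrB; apply: eq_bigr => k _; rewrite -sumrB; apply: eq_bigr => l _.
  by rewrite /Y ![i == _]eq_sym; ring.
have C0 : C = 0.
  apply: acQ => [|k l Qkl].
    split=> [k l|k l akl|k kP]; rewrite ?mxE; first by ring.
      by rewrite /Y (QN k l) Qoff// oppr0 eqxx !mul0r subrr.
    by have := net k; rewrite (negPf kP) mul0r add0r.
  by rewrite mxE /Y (QN k l) Qkl oppr0 eqxx !mul0r subrr.
rewrite big_sumType/= big1 ?add0r; last first.
  move=> k _; have := net k; rewrite big1 ?addr0 => [Pk|l _]; last by rewrite C0 mxE.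
  by rewrite mulrAC Pk mul0r.
rewrite sum_pairE/=.
set s := (X in X = 0).
have sE : s = \sum_k \sum_l e k l * Y k l.
  by apply: eq_bigr => k _; apply: eq_bigr => l _; rewrite /Y; ring.
(* [C = 0] makes [Y] symmetric, while [e] is antisymmetric. *)
have sN : s = - s.
  rewrite {2}sE -sumrN [LHS](_ : _ = \sum_l \sum_k e k l * Y k l); last first.
    by rewrite sE exchange_big.
  apply: eq_bigr => k _; rewrite -sumrN; apply: eq_bigr => l _.
  have /matrixP/(_ k l) := C0; rewrite !mxE => /eqP; rewrite subr_eq0 => /eqP ->.
  by rewrite eN mulNr.
lra.
Qed.

Lemma acyclic_network Q (c : R) : 0 < c -> is_flow Q -> acyclic Q ->
  exists kappa, [/\ physical G B kappa,
    dissipation G B kappa = c ^+ 2 * flow_cost Q &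
    material G kappa = flow_cost Q / c].
Proof.
move=> c0 FQ acQ; have [QN Qoff Qsum] := FQ.
(* The equality case [x^2 = c * s * d] of [cubic_AGM] in [penalty_ge_flow_cost], solved for the root
   [s] of the conductance. *)
pose s k l := cbrt (Q k l) ^+ 2 / (c * cbrt (weight G k l)).
pose kappa : 'M[R]_V := \matrix_(k, l) s k l ^+ 2.
have sC k l : s k l = s l k.
  have [akl|akl] := boolP (adj G k l).
    by rewrite /s (QN l k) cbrtN weight_sym.
  by rewrite /s (QN k l) cbrtN Qoff// cbrt0 expr0n/= !mul0r.
have s_ge0 k l : adj G k l -> 0 <= s k l.
  by move=> akl; rewrite divr_ge0 ?sqr_ge0// mulr_ge0 ?cbrt_ge0// ltW.
have kN : is_network G kappa.
  split=> [k l|k l akl|k l akl]; rewrite !mxE ?sqr_ge0//; first by rewrite sC.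
  by rewrite /s Qoff// cbrt0 expr0n/= mul0r expr0n.
have kneq0 k l : Q k l != 0 -> kappa k l != 0.
  move=> Qkl; have akl : adj G k l by apply: contra_neqT Qkl => /Qoff.
  rewrite mxE /s !expf_neq0// mulf_neq0 ?expf_neq0 ?invr_eq0 ?mulf_neq0//.
  - by rewrite gt_eqF ?cbrt_gt0.
  - by rewrite gt_eqF.
  - by rewrite gt_eqF ?cbrt_weight_gt0.
have keq0 k l : Q k l = 0 -> kappa k l = 0.
  by move=> Qkl; rewrite mxE /s Qkl cbrt0 expr0n/= mul0r expr0n.
have [|p [pP pE]] := @acyclic_potential Q (pbar B) (fun k l => Q k l / kappa k l) FQ acQ.
  by case: kN => ks _ _ k l; rewrite QN ks mulNr.
have KQ : is_kirchhoff_flow G B kappa Q.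
  have QE k l : Q k l = (p k - p l) * kappa k l.
    have [Qkl|Qkl] := eqVneq (Q k l) 0; first by rewrite keq0// mulr0.
    by rewrite pE// divfK// kneq0.
  exists p; split=> // k kP; rewrite -Qsum// -sum_adj//.
  by apply: eq_bigr => l _.
have kphys : physical G B kappa by apply: physicalP => //; exists Q.
have kflowE := kirchhoff_flow_uniq kN (kflowP kphys) KQ.
exists kappa; split=> //.
  rewrite -[dissipation _ _ _]/(edge_sum _) -edge_sumZ; apply: eq_edge_sum => k l akl.
  rewrite kflowE.
  have [Qkl|Qkl] := eqVneq (Q k l) 0.
    by rewrite Qkl cbrt0 expr0n/= !mul0r mulr0.
  rewrite -[Q k l ^+ 2]real_normK ?num_real// -cbrtK mxE /s.
  have := cbrt_weight_gt0 akl; have := cbrt_gt0 Qkl.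
  set x := cbrt _ => x0; set d := cbrt _ => d0.
  by field; rewrite !gt_eqF.
rewrite mulrC -[material _ _]/(edge_sum _) -edge_sumZ; apply: eq_edge_sum => k l akl.
rewrite mxE sqrtr_sqr ger0_norm ?s_ge0// -{1}(cbrt_weightK akl) /s.
have := cbrt_weight_gt0 akl; set d := cbrt _ => d0.
by field; rewrite !gt_eqF.
Qed.

End Flows.

(** * The optimal scale and the comparison of the two problems *)

Lemma penalty_optimum (R : realFieldType) (D M m c : R) :
  0 < m -> 0 < c -> 0 <= M ->
  (forall t, 0 < t -> 3 * t ^+ 2 * m <= D + 2 * t ^+ 3 * M) ->
  D + 2 * c ^+ 3 * M <= 3 * c ^+ 2 * m -> M = m / c /\ D <= c ^+ 2 * m.
Proof.
move=> m0 c0 M0 lb ub.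
(* If [M = 0], the bound at [t = 2 * c] gives [12 c^2 m <= D <= 3 c^2 m], which is absurd. *)
have [M00|Mn0] := eqVneq M 0.
  move: ub (lb (2 * c) ltac:(lra)); rewrite M00 !mulr0 !addr0 exprMn => ub.
  by have := mulr_gt0 (exprn_gt0 2 c0) m0; lra.
have {}M0 : 0 < M by rewrite lt_def Mn0.
have zpos : 0 < m / M by rewrite divr_gt0.
have mE : m = m / M * M by rewrite divfK.
(* [z = m / M] maximizes [3 t^2 m - 2 t^3 M], so it gives the sharpest lower bound on [D]. *)
have := lb _ zpos; move: ub; set z := m / M in zpos mE *; rewrite mE => ub lbz.
have : (z - c) ^+ 2 * (z + 2 * c) * M <= 0.
  rewrite -subr_ge0.
  suff -> : 0 - (z - c) ^+ 2 * (z + 2 * c) * M =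
    (3 * c ^+ 2 * (z * M) - (D + 2 * c ^+ 3 * M)) +
    (D + 2 * z ^+ 3 * M - 3 * z ^+ 2 * (z * M)) by rewrite addr_ge0// subr_ge0.
  by ring.
rewrite pmulr_lle0// pmulr_lle0; last by lra.
move=> le0; have /eqP : (z - c) ^+ 2 == 0 by rewrite eq_le le0 sqr_ge0.
move/eqP; rewrite sqrf_eq0 subr_eq0 => /eqP zc; move: ub; rewrite zc => ub.
split; first by rewrite mulrC mulKf// gt_eqF.
have -> : c ^+ 2 * (c * M) = 3 * c ^+ 2 * (c * M) - 2 * c ^+ 3 * M by ring.
by rewrite lerBrDr.
Qed.

Theorem corollary3p12 (R : realType) (V : nat)
    (G : prior_network R V) (B : boundary R V)
    (all_positive_physical : forall kappa : 'M[R]_V,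
      is_network G kappa -> (forall k l, adj G k l -> 0 < kappa k l) ->
      physical G B kappa)
    (flow_vertex : exists k, k \in fvert B) :
  exists K : R -> R,
    set_bij [set a : R | 0 < a]%classic [set x : R | 0 < x]%classic K /\
    forall a : R, 0 < a -> forall kappa : 'M[R]_V, physical G B kappa ->
      (min_dissipative_penalty G B a kappa <->
       min_dissipative_constraint G B (K a) kappa).
Proof.
pose costs : set R := [set flow_cost G Q | Q in is_flow G B]%classic.
have costs_n0 : (costs !=set0)%classic.
  pose one : 'M[R]_V := \matrix_(k, l) (adj G k l)%:R.
  have /kflow_is_flow F1 : physical G B one.
    apply: all_positive_physical => [|k l akl]; last by rewrite mxE akl ltr01.
    split=> k l; rewrite !mxE; first by rewrite adj_sym.
      by move=> ->; exact: ler01.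
    by move/negPf => ->.
  by exists (flow_cost G (kflow G B one)), (kflow G B one).
have [e e0 le_cost] := flow_cost_lbound G flow_vertex.
have costs_lb : has_lbound costs by exists e => _ [Q FQ <-]; exact: le_cost.
pose m := inf costs.
have m0 : 0 < m.
  by apply: lt_le_trans e0 _; apply: lb_le_inf => // _ [Q FQ <-]; exact: le_cost.
have m_le Q : is_flow G B Q -> m <= flow_cost G Q.
  by move=> FQ; apply: ge_inf => //; exists Q.
have penalty_lb kappa (c : R) : physical G B kappa -> 0 < c ->
    3 * c ^+ 2 * m <= dissipation G B kappa + 2 * c ^+ 3 * material G kappa.
  move=> kphys c0; apply: le_trans (penalty_ge_flow_cost c0 kphys).
  by apply: ler_wpM2l; [rewrite mulr_ge0 ?sqr_ge0 | exact/m_le/kflow_is_flow].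
exists (fun a => m / cbrt (a / 2)).
have half_neq0 (a : R) : 0 < a -> a / 2 != 0 by move=> a0; lra.
have cubeK (a : R) : 0 < a -> 2 * cbrt (a / 2) ^+ 3 = a.
  by move=> a0; rewrite cbrtK ger0_norm; lra.
split; [split => [a a0|a a' /set_mem/= a0 /set_mem/= a'0 KE|x x0]|] => /=.
- by rewrite divr_gt0// cbrt_gt0// half_neq0.
- by rewrite -(cubeK _ a0) -(cubeK _ a'0) (invr_inj (mulfI (lt0r_neq0 m0) KE)).
- have mx0 : 0 < m / x by rewrite divr_gt0.
  exists (2 * (m / x) ^+ 3); first by rewrite /= mulr_gt0// exprn_gt0.
  have -> : 2 * (m / x) ^+ 3 / 2 = (m / x) ^+ 3 by field; rewrite gt_eqF.
  by rewrite cbrtX ?(ltW mx0)// invf_div mulrC divfK// gt_eqF.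
move=> a a0 kappa kphys; have c0 := cbrt_gt0 (half_neq0 _ a0).
have aE := cubeK _ a0; move: c0 aE; set c := cbrt _ => c0 aE.
have c20 : 0 < c ^+ 2 by rewrite exprn_gt0.
have constraint_lb kappa' : physical G B kappa' -> material G kappa' = m / c ->
    c ^+ 2 * m <= dissipation G B kappa'.
  move=> k'phys k'M; have := penalty_lb _ _ k'phys c0; rewrite k'M.
  have -> : 2 * c ^+ 3 * (m / c) = 2 * c ^+ 2 * m by field; rewrite gt_eqF.
  by lra.
split=> [[_ kmin]|[_ kM kmin]].
  have [|kM kD] := penalty_optimum m0 c0 (material_ge0 G kappa)
      (fun t => penalty_lb kappa t kphys).
    (* It suffices to bound the penalty of [kappa] by [3 c^2] times the cost of each flow; an
       acyclic flow of no greater cost is realized by a competing network. *)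
    rewrite -ler_pdivrMl ?mulr_gt0//; apply: lb_le_inf => // _ [Q FQ <-].
    have [Q' [FQ' acQ' le_Q]] := reduce_acyclic FQ.
    apply: le_trans le_Q; rewrite ler_pdivrMl ?mulr_gt0//.
    have [kappa' [k'phys k'D k'M]] := acyclic_network c0 FQ' acQ'.
    rewrite aE; apply: le_trans (kmin _ k'phys) _; rewrite -aE k'D k'M.
    rewrite le_eqVlt; apply/orP; left; apply/eqP.
    by field; rewrite gt_eqF.
  split=> // kappa' k'phys k'M; apply: le_trans kD _.
  exact: constraint_lb.
have kD : dissipation G B kappa <= c ^+ 2 * m.
  have D0 : 0 <= dissipation G B kappa.
    by apply: le_trans (constraint_lb _ kphys kM); rewrite mulr_ge0// ltW.
  set D := dissipation _ _ _ in D0 *.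
  (* Competitors of material [m / c] give [D <= c^2 Phi^3 / m^2]. In terms of [r] this reads
     [r <= Phi], which passes to the infimum, and [r <= m] is the claim. *)
  pose r := cbrt (D * (m / c) ^+ 2).
  have rK : r ^+ 3 = D * (m / c) ^+ 2.
    by rewrite cbrtK ger0_norm// mulr_ge0// sqr_ge0.
  have rm : r <= m.
    apply: lb_le_inf => // _ [Q FQ <-].
    have [Q' [FQ' acQ' le_Q]] := reduce_acyclic FQ; apply: le_trans le_Q.
    have := m_le _ FQ'; set Phi := flow_cost G Q' => mPhi.
    have Phi0 : 0 < Phi := lt_le_trans m0 mPhi.
    (* The scale [c * Phi / m] gives the network of [Q'] the material [m / c]. *)
    have c'0 : 0 < c * Phi / m by rewrite divr_gt0// mulr_gt0.
    have [kappa' [k'phys k'D k'M]] := acyclic_network c'0 FQ' acQ'.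
    have := kmin _ k'phys; rewrite k'D k'M -/Phi -/D => /(_ _).
    have -> : Phi / (c * Phi / m) = m / c by field; rewrite !gt_eqF.
    move=> /(_ erefl) Dle.
    rewrite -(@ler_pXn2r _ 3)// ?nnegrE ?cbrt_ge0 ?(ltW Phi0)// rK.
    apply: (@le_trans _ _ ((c * Phi / m) ^+ 2 * Phi * (m / c) ^+ 2)).
      by rewrite ler_wpM2r// sqr_ge0.
    rewrite le_eqVlt; apply/orP; left; apply/eqP.
    by field; rewrite !gt_eqF.
  have : r ^+ 3 <= m ^+ 3 by rewrite lerXn2r// nnegrE ?cbrt_ge0// ltW.
  rewrite rK => rm3; have mc2 : 0 < (m / c) ^+ 2 by rewrite exprn_gt0// divr_gt0.
  rewrite -(ler_pM2r mc2); apply: (le_trans rm3).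
  rewrite le_eqVlt; apply/orP; left; apply/eqP.
  by field; rewrite gt_eqF.
split=> // kappa' k'phys; rewrite -aE.
apply: le_trans (penalty_lb _ _ k'phys c0); rewrite kM.
have -> : 2 * c ^+ 3 * (m / c) = 2 * c ^+ 2 * m by field; rewrite gt_eqF.
by lra.
Qed.
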